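(* If $D$ is a tournament, then the toric ideal $P_D$ is a binomial complete intersection.
   Context: A tournament is an oriented (finite) complete graph, i.e. $D=K_{\mathcal{O}}$ for a complete graph $K$ and an orientation $\mathcal{O}$ of its edges. Let $k$ be a field. For an oriented graph $D$ (from a finite simple graph) with vertices $x_1,\dots,x_n$, edges $t_1,\dots,t_q$ and $r$ connected components, associate to an oriented edge $t_\ell=(x_i,x_j)$ (from $x_i$ to $x_j$) the vector $v_\ell\in\{0,1,-1\}^n$ with $i$-th entry $-1$, $j$-th entry $1$ and all other entries $0$. The toric ideal $P_D$ is the kernel of the $k$-algebra map $\varphi:k[t_1,\dots,t_q]\to k[x_1^{\pm1},\dots,x_n^{\pm1}]$, $t_\ell\mapsto x^{v_\ell}$ (i.e. $t_\ell\mapsto x_jx_i^{-1}$). It has height $q-n+r$. $P_D$ is a binomial complete intersection if it can be generated by $q-n+r$ binomials (polynomials of the form $t^\alpha-t^\beta$). *)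

(* Defs.v *)
From HB Require Import structures.
From mathcomp Require Import all_boot all_order all_algebra.
From mathcomp Require Import boolp.
From mathcomp Require Import mpoly.

Set Implicit Arguments.
Unset Strict Implicit.
Unset Printing Implicit Defensive.

Import GRing.Theory.
Local Open Scope ring_scope.

Record sgraph (n : nat) := SGraph {
  adj :> rel 'I_n;
  adj_sym : forall i j, adj i j = adj j i;
  adj_irr : forall i, adj i i = false }.

Definition complete n (G : sgraph n) := forall i j : 'I_n, adj G i j = (i != j).

(* [arc i j] reads "there is an oriented edge from x_i to x_j"; every edge of  *)
(* the underlying graph receives exactly one of its two directions.           *)
Record ograph (n : nat) := OGraph {
  ugraph : sgraph n;
  arc : rel 'I_n;
  arc_adj : forall i j, arc i j -> adj ugraph i j;
  arc_orient : forall i j, adj ugraph i j -> arc i j (+) arc j i }.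

Definition tournament n (D : ograph n) := complete (ugraph D).

Section OrientedGraph.
Variables (n : nat) (D : ograph n).

Definition edges : {set 'I_n * 'I_n} := [set e | arc D e.1 e.2].

Definition nedges : nat := #|edges|.

Definition ncomponents : nat := n_comp (adj (ugraph D)) 'I_n.

Definition edge (l : 'I_nedges) : 'I_n * 'I_n := enum_val l.

Definition edge_vec (l : 'I_nedges) : 'rV[int]_n :=
  \row_i (if i == (edge l).1 then -1 else if i == (edge l).2 then 1 else 0).

End OrientedGraph.

(* The ring k[x_1^{+-1}, ..., x_n^{+-1}], realised as the subring of          *)
(* k(x_1, ..., x_n) of the fractions whose denominator is a monomial.         *)
Section Laurent.
Variables (k : fieldType) (n : nat).

Local Notation K := {fraction {mpoly k[n]}}.
Local Notation "p %:F" := (FracField.tofrac p) : ring_scope.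

Definition is_laurent : {pred K} :=
  fun f => `[< exists (p : {mpoly k[n]}) (m : 'X_{1..n}), f = p%:F / 'X_[m]%:F >].

Lemma is_laurentP f :
  reflect (exists (p : {mpoly k[n]}) (m : 'X_{1..n}), f = p%:F / 'X_[m]%:F)
          (f \in is_laurent).
Proof. exact: asboolP. Qed.

Lemma mpolyX_frac_neq0 (m : 'X_{1..n}) : ('X_[k, m])%:F != 0 :> K.
Proof. by rewrite tofrac_eq0 -msupp_eq0 msuppX. Qed.

Lemma is_laurent_subring : subring_closed is_laurent.
Proof.
split.
- by apply/is_laurentP; exists 1, 0%MM; rewrite mpolyX0 tofrac1 divr1.
- move=> f g /is_laurentP[p [a ->]] /is_laurentP[q [b ->]]; apply/is_laurentP.
  exists (p * 'X_[b] - q * 'X_[a]), (a + b)%MM.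
  rewrite mpolyXD tofracB !tofracM -mulNr addf_div ?mpolyX_frac_neq0 //.
  by rewrite mulNr.
- move=> f g /is_laurentP[p [a ->]] /is_laurentP[q [b ->]]; apply/is_laurentP.
  by exists (p * q), (a + b)%MM; rewrite mpolyXD !tofracM mulf_div.
Qed.

HB.instance Definition _ :=
  GRing.isSubringClosed.Build K is_laurent is_laurent_subring.

Record laurent := Laurent { lfrac :> K; lfracP : lfrac \in is_laurent }.

HB.instance Definition _ := [isSub for lfrac].
HB.instance Definition _ := [Choice of laurent by <:].
HB.instance Definition _ := [SubChoice_isSubComNzRing of laurent by <:].

Lemma lconst_subproof (c : k) : (c%:MP_[n])%:F \in is_laurent.
Proof.
by apply/is_laurentP; exists c%:MP, 0%MM; rewrite mpolyX0 tofrac1 divr1.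
Qed.

Definition lconst (c : k) : laurent := Laurent (lconst_subproof c).

Lemma lconst_is_zmod_morphism : zmod_morphism lconst.
Proof. by move=> a b; apply: val_inj; rewrite /= mpolyCB tofracB. Qed.

HB.instance Definition _ :=
  GRing.isZmodMorphism.Build k laurent lconst lconst_is_zmod_morphism.

Lemma lconst_is_monoid_morphism : monoid_morphism lconst.
Proof.
split; first by apply: val_inj; rewrite /= tofrac1.
by move=> a b; apply: val_inj; rewrite /= mpolyCM tofracM.
Qed.

HB.instance Definition _ :=
  GRing.isMonoidMorphism.Build k laurent lconst lconst_is_monoid_morphism.

Lemma lmonom_subproof (v : 'rV[int]_n) :
  \prod_(i < n) (('X_i : {mpoly k[n]})%:F ^ v 0 i) \in is_laurent.
Proof.
apply: rpred_prod => i _; apply/is_laurentP; case: (v 0 i) => d.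
  by exists ('X_i ^+ d), 0%MM; rewrite mpolyX0 tofrac1 divr1 tofracXn.
exists 1, (U_(i) *+ d.+1)%MM.
by rewrite tofrac1 mul1r -mpolyXn tofracXn NegzE exprnN.
Qed.

Definition lmonom (v : 'rV[int]_n) : laurent := Laurent (lmonom_subproof v).

End Laurent.

Section ToricIdeal.
Variables (k : fieldType) (n : nat) (D : ograph n).

Local Notation S := {mpoly k[nedges D]}.

Definition toric_map : S -> laurent k n :=
  mmap (@lconst k n) (fun l => lmonom k (edge_vec l)).

Definition toric_ideal (f : S) : Prop := toric_map f = 0.

End ToricIdeal.

Definition generated_by (R : comNzRingType) m (g : 'I_m -> R) (I : R -> Prop) :=
  forall f : R, I f <-> exists c : 'I_m -> R, f = \sum_(i < m) c i * g i.

Definition is_binomial (k : fieldType) q (f : {mpoly k[q]}) :=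
  exists a b : 'X_{1..q}, f = 'X_[a] - 'X_[b].

(* The number q - n + r of generators is written so that the truncated        *)
(* subtraction is exact: q + r >= n in every graph.                           *)
Definition binomial_complete_intersection (k : fieldType) n (D : ograph n) :=
  exists g : 'I_(nedges D + ncomponents D - n)%N -> {mpoly k[nedges D]},
    (forall i, is_binomial (g i)) /\ generated_by g (@toric_ideal k n D).

(* Main.v *)
(* Take a Hamiltonian path x_1, ..., x_n of the tournament (Redei), and let    *)
(* s_i be the variable of the edge from x_i to x_{i+1}.  Another edge t        *)
(* joining x_i and x_j, i < j, gives the binomial t - s_i ... s_{j-1} if it    *)
(* points forward and t s_i ... s_{j-1} - 1 if it points backward, which makes *)
(* q - n + 1 binomials of P_D.  Modulo them, each t is a monomial in the path  *)
(* variables or inverse to one, so the quotient is a localization of           *)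
(* k[s_1, ..., s_{n-1}], and this embeds in the Laurent ring because the       *)
(* vectors of the path edges are linearly independent.                         *)
Require Import Defs.
From mathcomp Require Import all_boot all_order all_algebra.
From mathcomp Require Import mpoly zify.
Import Defs.

Set Implicit Arguments.
Unset Strict Implicit.
Unset Printing Implicit Defensive.

Import GRing.Theory Num.Theory.
Local Open Scope ring_scope.

(** The localization argument is carried out on exponents. A monomial of exponent [a] maps to the
    Laurent monomial of exponent [wt edge_vec a], and distinct Laurent monomials are linearly
    independent ([lmonom_free]). Hence elements of P_D generate it as soon as their span contains
    every difference of two monomials of equal weight ([toric_ideal_span]). For the binomials of the
    edges off the path this is [congr_of_wt]: multiplying by denominators invertible modulo the
    binomials turns both monomials into path monomials, and these are determined by their weight
    ([wt_path_inj]). The path comes from [tournament_hamiltonian], and [card_path_edges] bounds the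
    number of generators. *)

(** * Linear independence of Laurent monomials *)

Section LaurentMonomials.
Variables (k : fieldType) (n : nat).
Implicit Types (u v w : 'rV[int]_n) (m : 'X_{1..n}).

Local Notation "p %:F" := (FracField.tofrac p) : ring_scope.

Lemma lmonom0 : lmonom k (0 : 'rV[int]_n) = 1.
Proof.
by apply: val_inj; rewrite /= big1 // => i _; rewrite mxE expr0z.
Qed.

Lemma lmonomD v w : lmonom k (v + w) = lmonom k v * lmonom k w.
Proof.
apply: val_inj; rewrite /= -big_split; apply: eq_bigr => i _ /=.
by rewrite mxE expfzDr // mpolyX_frac_neq0.
Qed.

Lemma lmonom_mnm m : lfrac (lmonom k (\row_i (m i)%:Z)) = 'X_[m]%:F.
Proof.
rewrite /= mpolyXE_id rmorph_prod; apply: eq_bigr => i _.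
by rewrite mxE -exprnP -tofracXn.
Qed.

(** Multiplying by a high power of the product of all variables clears the denominators; the
    coefficients of a polynomial then give the claim. *)
Lemma lmonom_free (I : eqType) (r : seq I) (c : I -> k) (u : I -> 'rV[int]_n) :
  \sum_(i <- r) lconst n (c i) * lmonom k (u i) = 0 ->
  forall w, \sum_(i <- r | u i == w) c i = 0.
Proof.
move=> sum0 w; pose h v := (\sum_j `|v 0%R j|)%N.
have hP v j : (`|v 0%R j| <= h v)%N by rewrite /h (bigD1 j) //= leq_addr.
(* [K] bounds every entry of [w] and of the [u i], so the shift by [K] makes all these exponents
   nonnegative. *)
pose K := (\sum_(i <- r) h (u i) + h w)%N.
have hr i : i \in r -> (h (u i) <= K)%N.
  by move=> ri; rewrite /K (big_rem i) //= -addnA leq_addr.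
pose s v : 'X_{1..n} := [multinom `|(v 0%R j + K%:Z)%R|%N | j < n].
have sE v : (h v <= K)%N -> \row_j (s v j)%:Z = v + const_mx K%:Z.
  move=> hv; apply/rowP=> j; rewrite !mxE mnmE.
  by move: (v 0 j) (leq_trans (hP v j) hv) => x; lia.
have s_inj v v' : (h v <= K)%N -> (h v' <= K)%N -> (s v == s v') = (v == v').
  move=> hv hv'; apply/eqP/eqP=> [ss'|-> //]; apply: (@addIr _ (const_mx K%:Z)).
  by rewrite -!sE // ss'.
have: \sum_(i <- r) c i *: 'X_[s (u i)] = 0 :> {mpoly k[n]}.
  apply/eqP; rewrite -tofrac_eq0 rmorph_sum /=.
  move/(congr1 (fun x => x * lmonom k (const_mx K%:Z))): sum0.
  rewrite mulr_suml mul0r => /(congr1 val) /eqP; congr (_ == _).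
  rewrite (raddf_sum val).
  rewrite !big_seq; apply: eq_bigr => i ri.
  rewrite -mulrA -lmonomD -sE ?hr //.
  by rewrite -mul_mpolyC tofracM -lmonom_mnm.
move/(congr1 (mcoeff (s w))); rewrite mcoeff0 raddf_sum /= => coef0.
rewrite -[RHS]coef0.
rewrite [LHS]big_mkcond [LHS]big_seq [RHS]big_seq; apply: eq_bigr => i ri.
rewrite mcoeffZ mcoeffX s_inj ?hr // ?leq_addl //.
by case: eqP; rewrite ?mulr1 ?mulr0.
Qed.

End LaurentMonomials.

Lemma sum_fibers_eq0 (R : pzRingType) (V : lmodType R) (I J : eqType) (r : seq I)
    (c : I -> R) (u : I -> J) (G : J -> V) :
  (forall w, \sum_(i <- r | u i == w) c i = 0) ->
  \sum_(i <- r) c i *: G (u i) = 0.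
Proof.
move=> c0; pose s := undup (map u r).
rewrite big_seq (eq_bigr (fun i => \sum_(w <- s | u i == w) c i *: G w)); last first.
  move=> i ri; rewrite (eq_bigl (pred1 (u i))) => [|w]; last by rewrite eq_sym.
  rewrite -big_filter filter_pred1_uniq ?undup_uniq ?big_seq1 //.
  by rewrite mem_undup map_f.
rewrite -big_seq (exchange_big_dep xpredT) //= big1 // => w _.
by rewrite -scaler_suml c0 scale0r.
Qed.

(** * Weights of exponents *)

Section Weights.
Variables (n q : nat) (v : 'I_q -> 'rV[int]_n).
Implicit Types a b c d : 'X_{1..q}.

Definition wt a : 'rV[int]_n := \sum_l v l *+ a l.

Lemma wt0 : wt 0%MM = 0.
Proof. by rewrite /wt big1 // => l _; rewrite mnm0E. Qed.

Lemma wtD a b : wt (a + b)%MM = wt a + wt b.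
Proof. by rewrite -big_split; apply: eq_bigr => l _; rewrite mnmDE mulrnDr. Qed.

Lemma wt1 l : wt U_(l)%MM = v l.
Proof.
rewrite /wt (bigD1 l) //= big1 ?addr0 ?mnm1E ?eqxx // => l' /negPf.
by rewrite mnm1E eq_sym => ->.
Qed.

End Weights.

(** * Congruences of exponents, modelling equality modulo the binomials *)

Section Congruence.
Variables (n q : nat) (v : 'I_q -> 'rV[int]_n) (path : pred 'I_q).
Variables (w : 'I_q -> 'X_{1..q}) (bwd : pred 'I_q).
Variable R : 'X_{1..q} -> 'X_{1..q} -> Prop.
Implicit Types a b c d : 'X_{1..q}.

Definition supported (a : 'X_{1..q}) := forall l, ~~ path l -> a l = 0%N.

Lemma supported0 : supported 0%MM.
Proof. by move=> l _; rewrite mnm0E. Qed.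

Lemma supportedD a b : supported a -> supported b -> supported (a + b)%MM.
Proof. by move=> sa sb l nl; rewrite mnmDE sa ?sb. Qed.

Lemma supported1 l : path l -> supported U_(l)%MM.
Proof. by move=> pl l' nl'; rewrite mnm1E; case: eqP nl' => // <-; rewrite pl. Qed.

Hypothesis R_refl : forall a, R a a.
Hypothesis R_sym : forall a b, R a b -> R b a.
Hypothesis R_trans : forall b a c, R a b -> R b c -> R a c.
Hypothesis R_addr : forall c a b, R a b -> R (a + c)%MM (b + c)%MM.
Hypothesis R_wt : forall a b, R a b -> wt v a = wt v b.
Hypothesis w_supp : forall l, supported (w l).
Hypothesis R_fwd : forall l, ~~ path l -> ~~ bwd l -> R U_(l)%MM (w l).
Hypothesis R_bwd : forall l, ~~ path l -> bwd l -> R (U_(l) + w l)%MM 0%MM.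
Hypothesis wt_inj :
  forall a b, supported a -> supported b -> wt v a = wt v b -> a = b.

Let addmACA a b c d : (a + b + (c + d) = (a + c) + (b + d))%MM.
Proof. by apply/mnmP=> i; rewrite !mnmDE addnACA. Qed.

Lemma congrD a b c d : R a b -> R c d -> R (a + c)%MM (b + d)%MM.
Proof.
move=> ab cd; apply: (R_trans (R_addr c ab)).
by rewrite ![(b + _)%MM]addmC; apply: R_addr.
Qed.

(* d is the denominator of a in the localization of the path variables; e is  *)
(* its inverse.                                                               *)
Lemma congr_supported a :
  exists d c e, [/\ supported d, supported c, R (a + d)%MM c & R (d + e)%MM 0%MM].
Proof.
pose Q x := exists d c e,
  [/\ supported d, supported c, R (x + d)%MM c & R (d + e)%MM 0%MM].
have Q0 : Q 0%MM.
  by exists 0%MM, 0%MM, 0%MM; rewrite addm0; split => //; apply: supported0.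
have QD x y : Q x -> Q y -> Q (x + y)%MM.
  move=> [d [c [e [sd sc xdc de]]]] [d' [c' [e' [sd' sc' ydc' de']]]].
  exists (d + d')%MM, (c + c')%MM, (e + e')%MM.
  split; try exact: supportedD.
    by rewrite addmACA; apply: congrD.
  by rewrite addmACA -[0%MM]addm0; apply: congrD.
rewrite [a]multinomUE_id; apply: (big_ind Q) => // l _.
suff QU : Q U_(l)%MM.
  elim: (a l) => [|i IH]; first by rewrite mulm0n.
  by rewrite mulmS; apply: QD.
have [pl|npl] := boolP (path l).
  exists 0%MM, U_(l)%MM, 0%MM.
  by rewrite !addm0; split => //; [apply: supported0|apply: supported1].
have [bl|nbl] := boolP (bwd l).
  (* For a backward edge the relation itself says that [w l] is invertible, with inverse the edge
     variable. *)
  exists (w l), 0%MM, U_(l)%MM; rewrite [(w l + _)%MM]addmC.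
  by split; rewrite ?supported0 //; try apply: supported0; apply: R_bwd.
exists 0%MM, (w l), 0%MM; rewrite !addm0.
by split => //; [apply: supported0|apply: R_fwd].
Qed.

(** Over the common denominator [d + d'] both sides become path monomials of equal weight, hence
    equal; [e + e'] then cancels the denominator. *)
Lemma congr_of_wt a b : wt v a = wt v b -> R a b.
Proof.
move=> ab.
have [d [c [e [sd sc adc de]]]] := congr_supported a.
have [d' [c' [e' [sd' sc' bdc de']]]] := congr_supported b.
have adc' : R (a + (d + d'))%MM (c + d')%MM by rewrite addmA; apply: R_addr.
have bdc' : R (b + (d + d'))%MM (c' + d)%MM.
  by rewrite [(d + _)%MM]addmC addmA; apply: R_addr.
have cc' : (c + d')%MM = (c' + d)%MM.
  apply: wt_inj; try exact: supportedD.
  by rewrite -(R_wt adc') -(R_wt bdc') wtD ab -wtD.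
have inv x : R (x + (d + d') + (e + e'))%MM x.
  rewrite -addmA -{2}[x]addm0; apply: congrD => //.
  by rewrite addmACA -[0%MM]addm0; apply: congrD.
apply: R_trans (R_sym (inv a)) _; apply: R_trans (inv b).
by apply: R_addr; apply: R_trans adc' _; rewrite cc'; apply: R_sym.
Qed.

End Congruence.

Section IdealSpan.
Variables (R : comNzRingType) (m : nat) (g : 'I_m -> R).

Definition ideal_span (f : R) := exists c : 'I_m -> R, f = \sum_(i < m) c i * g i.

Lemma ideal_span0 : ideal_span 0.
Proof. by exists (fun=> 0); rewrite big1 // => i _; rewrite mul0r. Qed.

Lemma ideal_spanD f h : ideal_span f -> ideal_span h -> ideal_span (f + h).
Proof.
move=> [c ->] [d ->]; exists (fun i => c i + d i).
by rewrite -big_split; apply: eq_bigr => i _; rewrite mulrDl.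
Qed.

Lemma ideal_spanM p f : ideal_span f -> ideal_span (p * f).
Proof.
move=> [c ->]; exists (fun i => p * c i).
by rewrite mulr_sumr; apply: eq_bigr => i _; rewrite mulrA.
Qed.

Lemma ideal_span_gen i : ideal_span (g i).
Proof.
exists (fun j => (j == i)%:R); rewrite (bigD1 i) //= eqxx mul1r big1 ?addr0 //.
by move=> j /negPf->; rewrite mul0r.
Qed.

End IdealSpan.

(** * Reduction of the toric ideal to binomials *)

Section ToricMap.
Variables (k : fieldType) (n : nat) (D : ograph n).
Local Notation q := (nedges D).
Local Notation ewt := (wt (@edge_vec n D)).

Lemma toric_mapX (a : 'X_{1..q}) : toric_map 'X_[a] = lmonom k (ewt a).
Proof.
rewrite /toric_map mmapX /mmap1 /wt.
rewrite (big_morph (@lmonom k n) (@lmonomD k n) (@lmonom0 k n)).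
apply: eq_bigr => l _; elim: (a l) => [|i IH]; first by rewrite lmonom0.
by rewrite exprS mulrS lmonomD IH.
Qed.

Lemma toric_ideal_span m (g : 'I_m -> {mpoly k[q]}) :
  (forall i, toric_ideal (g i)) ->
  (forall a b : 'X_{1..q}, ewt a = ewt b -> ideal_span g ('X_[a] - 'X_[b])) ->
  generated_by g (@toric_ideal k n D).
Proof.
move=> gP gwt f; split=> [f0|[c ->]]; last first.
  rewrite /toric_ideal /toric_map rmorph_sum big1 // => i _.
  by rewrite rmorphM [X in _ * X]gP mulr0.
(* One monomial of [f] is chosen per weight; the default is never reached on weights occurring in
   [f]. *)
pose rep u := head 0%MM [seq a <- msupp f | ewt a == u].
have rep_wt a : a \in msupp f -> ewt (rep (ewt a)) = ewt a.
  move=> fa; have: a \in [seq b <- msupp f | ewt b == ewt a].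
    by rewrite mem_filter eqxx.
  rewrite /rep; case E: [seq _ <- _ | _] => [//|b s] _ /=.
  have: b \in [seq b <- msupp f | ewt b == ewt a] by rewrite E mem_head.
  by rewrite mem_filter => /andP[/eqP].
have fib0 : \sum_(a <- msupp f) f@_a *: 'X_[rep (ewt a)] = 0 :> {mpoly k[q]}.
  apply: (sum_fibers_eq0 (fun u => 'X_[rep u])); apply: lmonom_free.
  rewrite -[RHS]f0 [in RHS](mpolyE f) /toric_map raddf_sum.
  by apply: eq_bigr => a _; rewrite -toric_mapX -mmapZ.
(* Subtracting the vanishing sum [fib0] writes [f] as a combination of differences of equal
   weight. *)
rewrite -/(ideal_span g f) [f]mpolyE -[X in ideal_span _ X]subr0.
rewrite -[X in _ - X]fib0 -sumrB big_seq.
apply: (big_ind (ideal_span g)) => [||a fa].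
- exact: ideal_span0.
- exact: ideal_spanD.
- by rewrite -scalerBr -mul_mpolyC; apply: ideal_spanM; apply: gwt; rewrite rep_wt.
Qed.

End ToricMap.

(** * Hamiltonian paths and the weights of their edges *)

Section HamiltonianPath.
Variables (n : nat) (D : ograph n).
Local Notation q := (nedges D).
Local Notation ewt := (wt (@edge_vec n D)).
Local Notation δ x := (delta_mx 0 x : 'rV[int]_n).

Lemma arc_neq x y : arc D x y -> x != y.
Proof.
by move=> /arc_adj; apply: contraTneq => ->; rewrite adj_irr.
Qed.

Lemma edge_arc (l : 'I_q) : arc D (edge l).1 (edge l).2.
Proof. by have := enum_valP l; rewrite inE. Qed.

Lemma arc_edge x y : arc D x y -> exists l : 'I_q, edge l = (x, y).
Proof.
move=> xy; have xyE : (x, y) \in edges D by rewrite inE.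
by exists (enum_rank_in xyE (x, y)); rewrite /edge enum_rankK_in.
Qed.

Lemma edge_vecE (l : 'I_q) : edge_vec l = δ (edge l).2 - δ (edge l).1.
Proof.
apply/rowP=> i; rewrite !mxE eqxx /=.
have /negPf := arc_neq (edge_arc l); case: (i =P (edge l).1) => [-> ->|_ _].
  by rewrite sub0r.
by rewrite subr0; case: (i == _).
Qed.

(* Sorting needs totality only, not transitivity: this is Redei's theorem. *)
Lemma tournament_hamiltonian (hD : tournament D) :
  exists s : seq 'I_n, [/\ uniq s, forall x, x \in s &
    forall x0 i, (i.+1 < size s)%N -> arc D (nth x0 s i) (nth x0 s i.+1)].
Proof.
(* Totality includes the diagonal, where there is no arc; uniqueness of [s] later excludes
   equality. *)
pose e x y := (x == y) || arc D x y.
have e_total : total e.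
  move=> x y; rewrite /e; case: (eqVneq x y) => //= xy.
  by have := @arc_orient _ D x y; rewrite hD xy => /(_ isT); do 2!case: arc.
exists (sort e (enum 'I_n)); set s := sort _ _.
have s_uniq : uniq s by rewrite sort_uniq enum_uniq.
split=> // [x|x0 i i_s]; first by rewrite mem_sort mem_enum.
have /(sortedP x0)/(_ i i_s)/orP[|//] := sort_sorted e_total (enum 'I_n).
by rewrite nth_uniq ?(ltnW i_s) // eqn_leq ltnn andbF.
Qed.

Variable s : seq 'I_n.
Hypothesis s_uniq : uniq s.
Hypothesis s_full : forall x, x \in s.
Hypothesis s_arc :
  forall x0 i, (i.+1 < size s)%N -> arc D (nth x0 s i) (nth x0 s i.+1).

Local Notation pos x := (index x s).

Definition path_edge (l : 'I_q) := pos (edge l).2 == (pos (edge l).1).+1.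

Lemma pos_inj : injective (fun x => pos x).
Proof. by move=> x y; apply: (index_inj x (s_full x) (s_full y)). Qed.

Lemma path_edge_pred y : (0 < pos y)%N ->
  exists2 l, path_edge l & (edge l).2 = y.
Proof.
move=> y_gt0; have y_s : (pos y < size s)%N by rewrite index_mem.
have := @s_arc y (pos y).-1; rewrite prednK // nth_index // => /(_ y_s).
move=> /arc_edge[l lE]; exists l; rewrite ?lE // /path_edge lE /=.
by rewrite index_uniq ?prednK // ltnW.
Qed.

(** The vectors of the path edges from [x] to [y] telescope. *)
Lemma path_monomial x y : (pos x <= pos y)%N ->
  exists2 w : 'X_{1..q}, supported path_edge w & ewt w = δ y - δ x.
Proof.
move=> xy; have [d] : {d | pos y = pos x + d}%N.
  by exists (pos y - pos x)%N; rewrite subnKC.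
elim: d y {xy} => [|d IH] y yE.
  move: yE; rewrite addn0 => /pos_inj->.
  by exists 0%MM; [apply: supported0|rewrite wt0 subrr].
have [|l l_path lE] := @path_edge_pred y; first by rewrite yE addnS.
have [|w w_supp wE] := IH (edge l).1.
  by apply: succn_inj; rewrite -addnS -yE -lE; rewrite (eqP l_path).
exists (w + U_(l))%MM; first by apply: supportedD => //; apply: supported1.
by rewrite wtD wt1 edge_vecE wE lE addrC addrA subrK.
Qed.

(** Every vertex but the first is the head of a path edge, and a nonempty graph has a component to
    account for the first. *)
Lemma card_path_edges : (n <= #|path_edge| + ncomponents D)%N.
Proof.
case: (posnP n) => [n0|n_gt0]; first by apply: (@leq_trans 0); rewrite ?n0.
pose x0 := Ordinal n_gt0.
have comp_gt0 : (0 < ncomponents D)%N.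
  rewrite /ncomponents /n_comp_mem; apply/card_gt0P.
  exists (fingraph.root (ugraph D) x0); rewrite !inE andbT.
  by apply: roots_root; apply: sym_connect_sym; apply: adj_sym.
rewrite addnC; apply: (@leq_trans #|[set: 'I_n]|).
  by rewrite cardsT card_ord.
pose A := nth x0 s 0 |: [set (edge l).2 | l in path_edge].
have sub : [set: 'I_n] \subset A.
  apply/subsetP=> y _; apply/setU1P; case: (posnP (pos y)) => [y0|].
    by left; rewrite -y0 nth_index.
  by move=> /path_edge_pred[l lp <-]; right; apply: imset_f.
apply: leq_trans (subset_leq_card sub) _.
apply: leq_trans (leq_card_setU _ _) _.
by rewrite cards1 leq_add // leq_imset_card.
Qed.

Lemma wt_path_inj a b :
  supported path_edge a -> supported path_edge b -> ewt a = ewt b -> a = b.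
Proof.
(* Summing the weight over the vertices up to the tail of a path edge keeps, *)
(* up to sign, only the multiplicity of that edge.                           *)
pose F r (v : 'rV[int]_n) := \sum_(x | (pos x <= r)%N) v 0 x.
have Fδ r x : F r (δ x) = (pos x <= r)%N%:R.
  rewrite /F big_mkcond (bigD1 x) //= big1 ?addr0 => [|y /negPf yx].
    by rewrite mxE !eqxx; case: leq.
  by rewrite mxE eqxx /= yx if_same.
have FB r v1 v2 : F r (v1 - v2) = F r v1 - F r v2.
  by rewrite /F -sumrB; apply: eq_bigr => x _; rewrite !mxE.
have Fwt l a' : path_edge l -> supported path_edge a' ->
    F (pos (edge l).1) (ewt a') = - (a' l)%:R.
  move=> lp sa; rewrite /F /wt.
  under eq_bigr do rewrite summxE.
  rewrite exchange_big /= (bigD1 l) //= [X in _ + X]big1 ?addr0 => [|l' l'l].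
    under eq_bigr do rewrite mulmxnE.
    rewrite sumrMnl -/(F _ _) edge_vecE FB !Fδ (eqP lp) ltnn leqnn.
    by rewrite sub0r mulNrn.
  under eq_bigr do rewrite mulmxnE.
  rewrite sumrMnl -/(F _ _); have [l'p|l'np] := boolP (path_edge l').
    rewrite edge_vecE FB !Fδ (eqP l'p) ltn_neqAle.
    (* Any other path edge has both ends on the same side of the cut, so it contributes zero. *)
    suff -> : pos (edge l').1 != pos (edge l).1 by rewrite subrr mul0rn.
    apply: contra_neq l'l => e1; apply: enum_val_inj; apply/eqP.
    rewrite -/(edge l') -/(edge l) [edge l']surjective_pairing.
    rewrite [edge l]surjective_pairing.
    rewrite (pos_inj e1) -pair_eqE /= eqxx /=; apply/eqP/pos_inj.
    by rewrite (eqP l'p) (eqP lp) e1.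
  by rewrite sa ?mulr0n.
move=> sa sb ab; apply/mnmP=> l; have [lp|lnp] := boolP (path_edge l).
  have := Fwt l a lp sa; rewrite ab Fwt // => /oppr_inj /eqP.
  by rewrite eqr_nat => /eqP.
by rewrite sa ?sb.
Qed.

End HamiltonianPath.

(** * Binomials of the edges off the path *)

Theorem corollary5p7 (k : fieldType) (n : nat) (D : ograph n) (hD : tournament D) :
  binomial_complete_intersection k D.
Proof.
have [s [s_uniq s_full s_arc]] := tournament_hamiltonian hD.
set q := nedges D; pose ewt := wt (@edge_vec n D); pose path := @path_edge n D s.
pose bwd (l : 'I_q) := (index (edge l).2 s < index (edge l).1 s)%N.
(* [w l] always runs forward along the path, hence the sign when [l] points backward. *)
have /fin_all_exists[w wP] : forall l : 'I_q, exists w : 'X_{1..q},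
    supported path w /\ ewt w = if bwd l then - edge_vec l else edge_vec l.
  move=> l; rewrite edge_vecE opprB /bwd.
  by case: ltnP => [/ltnW|] /(path_monomial s_uniq s_full s_arc)[w ? ?]; exists w.
pose gen l := if bwd l then 'X_[U_(l) + w l] - 'X_[0] else 'X_[U_(l)] - 'X_[w l]
  : {mpoly k[q]}.
pose gens := [seq gen l | l <- enum (predC path)].
have gens_size : (size gens <= q + ncomponents D - n)%N.
  rewrite size_map -cardE leq_subRL; last first.
    apply: leq_trans (card_path_edges s_uniq s_full s_arc) _.
    by rewrite leq_add2r -[X in (_ <= X)%N]card_ord max_card.
  rewrite -[X in (_ <= X + _)%N]card_ord -(cardC path) addnAC leq_add2r.
  exact: card_path_edges s_uniq s_full s_arc.
(* The default value 0 of nth is itself a binomial, so gens_size suffices. *)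
pose g (i : 'I_(q + ncomponents D - n)) := nth 0 gens i.
have gP i : exists a b, g i = 'X_[a] - 'X_[b] /\ ewt a = ewt b.
  have [gi|gi] := ltnP i (size gens); last first.
    by exists 0%MM, 0%MM; rewrite /g nth_default // subrr.
  have /mapP[l _ ->] : g i \in gens by apply: mem_nth.
  have [_] := wP l; rewrite /gen /ewt; case: (bwd l) => wE.
    by exists (U_(l) + w l)%MM, 0%MM; rewrite wtD wt1 wE wt0 subrr.
  by exists U_(l)%MM, (w l); rewrite wt1 wE.
have gen_span l : ~~ path l -> ideal_span g (gen l).
  move=> npl; have: gen l \in gens by rewrite map_f ?mem_enum.
  move=> /(nthP 0)[i ig <-].
  exact: (ideal_span_gen g (Ordinal (leq_trans ig gens_size))).
exists g; split=> [i|]; first by have [a [b [-> _]]] := gP i; exists a, b.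
apply: toric_ideal_span => [i|].
  have [a [b [-> ab]]] := gP i.
  rewrite /toric_ideal /toric_map mmapB -!/(toric_map _) !toric_mapX.
  by rewrite -/ewt ab subrr.
(* Equality of weights is built into [R] because [congr_of_wt] asks that the congruence preserve
   weights. *)
pose R a b := ewt a = ewt b /\ ideal_span g ('X_[a] - 'X_[b]).
suff RP a b : ewt a = ewt b -> R a b by move=> a b /RP[].
apply: (@congr_of_wt _ _ _ path w bwd).
- by move=> c; split=> //; rewrite subrr; apply: ideal_span0.
- move=> c d [cd icd]; split=> //.
  by rewrite -opprB -mulN1r; apply: ideal_spanM.
- move=> d c e [cd icd] [de ide]; split; first by rewrite cd.
  by rewrite -[X in X - _](subrK 'X_[d]) -addrA; apply: ideal_spanD.
- move=> e c d [cd icd]; split; first by rewrite /ewt !wtD -/ewt cd.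
  by rewrite !mpolyXD -mulrBl mulrC; apply: ideal_spanM.
- by move=> c d [].
- by move=> l; have [] := wP l.
- move=> l npl /negPf nbl; have := wP l; rewrite nbl => -[_ wE].
  split; first by rewrite /ewt wt1 -/ewt wE.
  by have := gen_span l npl; rewrite /gen nbl.
- move=> l npl bl; have := wP l; rewrite bl => -[_ wE].
  split; first by rewrite /ewt wt0 wtD wt1 -/ewt wE subrr.
  by have := gen_span l npl; rewrite /gen bl.
- exact: wt_path_inj.
Qed.
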